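(* Let $X$ be a set and let $\varnothing\neq Z\subseteq Y\subseteq X$. Let $\alpha\in\mathcal{T}(X,Y,Z)$. Then the following conditions are equivalent: (i) $\alpha\in\mathrm{Reg}(\mathcal{T}(X,Y,Z))$; (ii) $X\alpha\cap Y\subseteq Z\alpha$; (iii) $X\alpha\cap Y=Z\alpha$.
   Context: $\mathcal{T}(X)$ is the full transformation semigroup on $X$ (all maps $X\to X$ under composition). Maps are written on the right, so $x(\alpha\beta)=(x\alpha)\beta$, and $A\alpha=\{a\alpha : a\in A\}$ for $A\subseteq X$. For $\varnothing\neq Z\subseteq Y\subseteq X$, $\mathcal{T}(X,Y,Z)=\{\alpha\in\mathcal{T}(X): Y\alpha\subseteq Z\}$, a subsemigroup of $\mathcal{T}(X)$. An element $x$ of a semigroup $S$ is regular in $S$ if $x=xyx$ for some $y\in S$; $\mathrm{Reg}(S)$ is the set of regular elements of $S$. *)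

(* Defs.v *)
From HB Require Import structures.
From mathcomp Require Import all_boot.
From mathcomp Require Import boolp classical_sets.

Set Implicit Arguments.
Unset Strict Implicit.
Unset Printing Implicit Defensive.

Local Open Scope classical_set_scope.
Local Open Scope group_scope.

Definition Reg (S : semigroupType) : set S :=
  [set x | exists y : S, x = x * y * x].
Arguments Reg : clear implicits.

Definition transf (X : Type) : Type := X -> X.

Identity Coercion fun_of_transf : transf >-> Funclass.

Section FullTransformationSemigroup.
Variable X : Type.

(* Maps are written on the right: x(ab) = (xa)b, so a * b applies a first. *)
Definition transf_mul (a b : transf X) : transf X := fun x => b (a x).

Lemma transf_mulA : associative transf_mul.
Proof. by []. Qed.

HB.instance Definition _ := gen_eqMixin (transf X).
HB.instance Definition _ := gen_choiceMixin (transf X).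
HB.instance Definition _ := isSemigroup.Build (transf X) transf_mulA.

End FullTransformationSemigroup.

Definition transf_set (X : Type) (Y Z : set X) : set (transf X) :=
  [set a | a @` Y `<=` Z].

(* The semigroup T(X, Y, Z); the inclusion of Z in Y is a parameter because
   closure under composition depends on it. *)
Record transf_sub (X : Type) (Y Z : set X) (ZY : Z `<=` Y) := TransfSub {
  transf_sub_val :> transf X;
  _ : transf_sub_val \in transf_set Y Z
}.

Section RestrictedTransformationSemigroup.
Variables (X : Type) (Y Z : set X) (ZY : Z `<=` Y).

Lemma transf_set_mulg_closed : mulg_closed (mem (transf_set Y Z)).
Proof.
move=> a b; rewrite !inE => aYZ bYZ _ [y Yy <-].
by apply: bYZ; exists (a y) => //; apply/ZY/aYZ; exists y.
Qed.

HB.instance Definition _ := [isSub for @transf_sub_val X Y Z ZY].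
HB.instance Definition _ := [Choice of transf_sub ZY by <:].
HB.instance Definition _ := SubChoice_isSubSemigroup.Build (transf X)
  _ (transf_sub ZY) transf_set_mulg_closed.

End RestrictedTransformationSemigroup.

(* Main.v *)
Require Import Defs.
From mathcomp Require Import all_boot.
From mathcomp Require Import boolp classical_sets.

Local Open Scope classical_set_scope.

(** If [alpha = alpha * b * alpha], a point [u] of [Y] in the image of [alpha] is the image of
    [b u], which lies in [Z]. Conversely, a suitable [b] is a choice of preimages under [alpha],
    taken in [Z] for points of [Y]; (iii) provides exactly these. *)

Lemma transf_subP (X : Type) (Y Z : set X) (ZY : Z `<=` Y)
    (a : transf_sub ZY) (x : X) : Y x -> Z (a x).
Proof.
by move=> Yx; have := valP a; rewrite inE; apply; exists x.
Qed.

Theorem theorem2p1 (X : Type) (Y Z : set X) (Z0 : Z !=set0) (ZY : Z `<=` Y)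
    (alpha : transf_sub ZY) :
  [<-> Reg (transf_sub ZY) alpha;
       (alpha @` [set: X]) `&` Y `<=` alpha @` Z;
       (alpha @` [set: X]) `&` Y = alpha @` Z].
Proof.
tfae.
- move=> [b alphaE] _ [[x _ <-] Yax].
  exists (b (alpha x)); first exact: transf_subP.
  by rewrite [in RHS]alphaE.
- move=> sub; apply/seteqP; split=> // _ [z Zz <-].
  (* [alpha] sends [Z], as a part of [Y], into [Z] and so into [Y]. *)
  by split; [exists z | apply/ZY/transf_subP/ZY].
- move=> imE; have [z0 Zz0] := Z0.
  have /choice[b bP] u : exists v,
      (Y u -> Z v) /\ ((alpha @` [set: X]) u -> alpha v = u).
    (* Off the image only membership in [Z] can be required, so [z0] serves as default value. *)
    have [imu|nimu] := pselect ((alpha @` [set: X]) u); last by exists z0.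
    have [Yu|nYu] := pselect (Y u); last by case: imu => v _ vu; exists v.
    have : (alpha @` Z) u by rewrite -imE.
    by case=> v Zv vu; exists v.
  have bYZ : b \in transf_set Y Z.
    by rewrite inE => _ [u Yu <-]; apply: (bP u).1.
  exists (TransfSub ZY bYZ); apply/val_inj/funext => x.
  by symmetry; apply: (bP (alpha x)).2; exists x.
Qed.
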